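(* Let $E$ and $F$ be Banach lattices and let $T:E\to F$ be a uaw-Dunford–Pettis operator. Then $T$ is Dunford–Pettis if one of the following holds: (1) the lattice operations in $E$ are weakly sequentially continuous; (2) $E$ is discrete with an order continuous norm; (3) $T$ is positive and $F$ is discrete with an order continuous norm.
   Context: All operators are continuous linear operators. A net $(x_\alpha)$ in a Banach lattice $E$ is uaw-convergent to $x$ (written $x_\alpha\xrightarrow{uaw}x$) if $|x_\alpha-x|\wedge u\to 0$ weakly for every $u\in E_+$. An operator $T$ from a Banach lattice $E$ into a Banach space $X$ is uaw-Dunford–Pettis if for every norm bounded sequence $(x_n)$ in $E$ with $x_n\xrightarrow{uaw}0$ one has $\|Tx_n\|\to 0$. An operator is Dunford–Pettis if it maps weakly null sequences to norm null sequences. A Banach lattice has weakly sequentially continuous lattice operations if $x_n\to 0$ weakly implies $|x_n|\to 0$ weakly. *)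

(* Defs.v *)
From HB Require Import structures.
From mathcomp Require Import all_boot all_order all_algebra.
From mathcomp Require Import all_classical all_reals all_analysis.
Set Implicit Arguments. Unset Strict Implicit. Unset Printing Implicit Defensive.
Import Order.TTheory GRing.Theory Num.Theory.
Import numFieldNormedType.Exports.
Local Open Scope classical_set_scope.
Local Open Scope ring_scope.

Section BanachLattice.
Variable R : realType.

Definition bounded_linear (E F : normedModType R) (T : E -> F) : Prop :=
  (forall (a : R) (x y : E), T (a *: x + y) = a *: T x + T y) /\ continuous T.

Definition dual_elt (E : normedModType R) (f : E -> R) : Prop :=
  (forall (a : R) (x y : E), f (a *: x + y) = a * f x + f y) /\ continuous f.

Section Lattice.
Variable E : normedModType R.
Variable le : E -> E -> Prop.
Variable join : E -> E -> E.

Definition meet (x y : E) : E := - join (- x) (- y).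
Definition labs (x : E) : E := join x (- x).

(* E is a Banach lattice: a Riesz space (ordered vector space that is a
   lattice, with [join] the least upper bound) whose (complete) norm is a
   lattice norm. Completeness comes from the type (completeNormedModType). *)
Definition banach_lattice : Prop :=
  (forall x, le x x) /\
      (forall x y, le x y -> le y x -> x = y) /\
      (forall x y z, le x y -> le y z -> le x z) /\
      (forall x y z, le x y -> le (x + z) (y + z)) /\
      (forall (a : R) x y, 0 <= a -> le x y -> le (a *: x) (a *: y)) /\
      (forall x y, le x (join x y) /\ le y (join x y)) /\
      (forall x y z, le x z -> le y z -> le (join x y) z) /\
      (forall x y, le (labs x) (labs y) -> `|x| <= `|y|).

Definition weakly_cvg (x : nat -> E) (l : E) : Prop :=
  forall f : E -> R, dual_elt f -> (fun n => f (x n)) @ \oo --> f l.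

Definition uaw_cvg (x : nat -> E) (l : E) : Prop :=
  forall u : E, le 0 u -> weakly_cvg (fun n => meet (labs (x n - l)) u) 0.

Definition norm_bounded (x : nat -> E) : Prop :=
  exists M : R, forall n, `|x n| <= M.

Definition wsc_lattice_ops : Prop :=
  forall x : nat -> E, weakly_cvg x 0 -> weakly_cvg (fun n => labs (x n)) 0.

Definition lt (x y : E) : Prop := le x y /\ x <> y.
Definition atom (a : E) : Prop :=
  lt 0 a /\ forall x, le 0 x -> le x a -> exists l : R, x = l *: a.
Definition discrete : Prop :=
  forall x, lt 0 x -> exists a, atom a /\ le a x.

Definition order_continuous_norm : Prop :=
  forall (I : Type) (leI : I -> I -> Prop) (x : I -> E),
    (exists i : I, True) ->
    (forall i, leI i i) ->
    (forall i j k, leI i j -> leI j k -> leI i k) ->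
    (forall i j, exists k, leI i k /\ leI j k) ->
    (forall i j, leI i j -> le (x j) (x i)) ->
    (forall i, le 0 (x i)) ->
    (forall z, (forall i, le z (x i)) -> le z 0) ->
    forall eps : R, 0 < eps ->
      exists i0, forall i, leI i0 i -> `|x i| < eps.
End Lattice.

Section Operators.
Variables (E F : normedModType R).

Definition dunford_pettis (T : E -> F) : Prop :=
  forall x : nat -> E, weakly_cvg x 0 -> (fun n => `|T (x n)|) @ \oo --> (0 : R).

Definition uaw_dunford_pettis (leE : E -> E -> Prop) (joinE : E -> E -> E)
  (T : E -> F) : Prop :=
  forall x : nat -> E, norm_bounded x -> uaw_cvg leE joinE x 0 ->
    (fun n => `|T (x n)|) @ \oo --> (0 : R).

Definition positive_op (leE : E -> E -> Prop) (leF : F -> F -> Prop)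
  (T : E -> F) : Prop := forall x, leE 0 x -> leF 0 (T x).
End Operators.
End BanachLattice.

(* Main.v *)
Require Import Defs.
From HB Require Import structures.
From mathcomp Require Import all_boot all_order all_algebra.
From mathcomp Require Import all_classical all_reals all_analysis.
From mathcomp Require Import ring lra.
Import Order.TTheory GRing.Theory Num.Theory.
Import numFieldNormedType.Exports.
Local Open Scope ring_scope.

(** A weakly null sequence is norm bounded, so it suffices to reach a uaw-null
    sequence. In case (1), [|x_n| /\ u] lies below the weakly null [|x_n|] and is
    weakly null because positive parts of functionals exist. In case (2),
    [|x_n| /\ a] tends to [0] in norm for each atom [a], by continuity of the
    coordinate along [a], and order continuity of the norm passes from atoms to
    arbitrary [u]. In case (3), a gliding hump gives [u] with
    [|T (|x_n| - u)^+| < e] for all [n]; as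
    [|T x_n| <= |T x_n| /\ T u + T (|x_n| - u)^+] and [T x_n] is weakly null,
    the argument of (2) in [F] concludes. *)

Set Implicit Arguments. Unset Strict Implicit. Unset Printing Implicit Defensive.

(** * Norming functionals *)

Section HahnBanach.
Context {R : realType} {E : normedModType R}.
Implicit Types (p q : E -> R) (x y : E).

(** Homogeneity is asked as an inequality only; applying it to [a^-1] as well gives equality. *)
Definition sublinear q : Prop :=
  (forall x y, q (x + y) <= q x + q y) /\
  (forall (a : R) x, 0 < a -> q (a *: x) <= a * q x).

Lemma sublinear0 q : sublinear q -> q 0 = 0.
Proof.
move=> [_ qZ]; have h2 := qZ 2 0 ltac:(lra); have h3 := qZ 2^-1 0 ltac:(lra).
by rewrite !scaler0 in h2 h3; lra.
Qed.

Lemma sublinearZ q (a : R) x : sublinear q -> 0 <= a -> q (a *: x) = a * q x.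
Proof.
move=> sq; rewrite le_eqVlt => /predU1P[<-|a0].
  by rewrite scale0r mul0r sublinear0.
apply/eqP; rewrite eq_le sq.2//= -ler_pdivlMl//.
rewrite -{1}[x](@scalerK _ _ a) ?gt_eqF// sq.2// invr_gt0//.
Qed.

Lemma sublinear_ge q x : sublinear q -> - q (- x) <= q x.
Proof.
by move=> sq; have := sq.1 x (- x); rewrite subrr sublinear0//; lra.
Qed.

Lemma norm_sublinear : sublinear (fun x => `|x|).
Proof.
split=> [x y|a x a0]; first exact: ler_normD.
by rewrite normrZ gtr0_norm.
Qed.

(* If [q] is minimal then [slide q y = q], and [t = 1] gives additivity of [q]. *)
Definition slide q y x : R :=
  inf [set q (x + t *: y) - t * q y | t in [set t | 0 <= t]]%classic.

Lemma slide_has_lbound q y x : sublinear q ->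
  has_lbound [set q (x + t *: y) - t * q y | t in [set t | 0 <= t]]%classic.
Proof.
(* The bound comes from [t *: y = (x + t *: y) - x]. *)
move=> sq; exists (- q (- x)) => _ [t /= t0 <-].
have := sq.1 (x + t *: y) (- x); rewrite addrAC subrr add0r sublinearZ//; lra.
Qed.

Lemma slide_le q y x (t : R) : sublinear q -> 0 <= t ->
  slide q y x <= q (x + t *: y) - t * q y.
Proof.
move=> sq t0; apply: ge_inf; first exact: slide_has_lbound.
by exists t.
Qed.

Lemma le_slide q y x c : (forall t : R, 0 <= t -> c <= q (x + t *: y) - t * q y) ->
  c <= slide q y x.
Proof.
move=> h; apply: lb_le_inf; last by move=> _ [t /= t0 <-]; exact: h.
by exists (q (x + 0 *: y) - 0 * q y); exists 0 => /=.
Qed.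

Lemma slide_le_self q y x : sublinear q -> slide q y x <= q x.
Proof.
move=> sq; have := @slide_le q y x 0 sq (lexx _).
by rewrite scale0r addr0 mul0r subr0.
Qed.

(** Parameters [t] for [x] and [s] for [z] combine to [t + s] for [x + z]; scaling by [a] turns [t]
    into [a * t]. *)
Lemma slide_sublinear q y : sublinear q -> sublinear (slide q y).
Proof.
move=> sq; split=> [x z|a x a0].
  rewrite -lerBlDr; apply: le_slide => t t0.
  rewrite lerBlDl -lerBlDr; apply: le_slide => s s0.
  have := @slide_le q y (x + z) (t + s) sq (addr_ge0 t0 s0).
  have := sq.1 (x + t *: y) (z + s *: y).
  by rewrite addrACA -scalerDl; lra.
rewrite -ler_pdivrMl//; apply: le_slide => t t0.
rewrite ler_pdivrMl//.
have := @slide_le q y (a *: x) (a * t) sq (mulr_ge0 (ltW a0) t0).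
rewrite -scalerA -scalerDr (sublinearZ _ sq (ltW a0))//. lra.
Qed.

(** Zorn's lemma applies to the sublinear functionals below [p]: the pointwise infimum of a chain is
    finite, being at least [- p (- x)], and is again sublinear. *)
Lemma minimal_sublinear p : sublinear p ->
  exists q, [/\ sublinear q, forall x, q x <= p x &
    forall r, sublinear r -> (forall x, r x <= q x) -> r = q].
Proof.
move=> sp.
pose P (q : E -> R) := sublinear q /\ forall x, q x <= p x.
pose T := {q : E -> R | P q}.
(* The order is reversed, so that a maximal element is a minimal functional. *)
pose below (s t : T) := `[< forall x, sval t x <= sval s x >].
have [||||[q Pq] qmin] := @Zorn T below.
- by move=> t; apply/asboolP.
- move=> r s t /asboolP h1 /asboolP h2; apply/asboolP => x.
  exact: le_trans (h2 x) (h1 x).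
- move=> [s Ps] [t Pt] /asboolP h1 /asboolP h2; apply: eq_exist.
  by apply/funext => x; apply/eqP; rewrite eq_le h1 h2.
- move=> A totA; have [->|/set0P [q0 Aq0]] := eqVneq A set0.
    by exists (exist _ p (conj sp (fun x => lexx _))).
  pose V x := [set sval q x | q in A]%classic.
  have lbV x : has_lbound (V x).
    exists (- p (- x)) => _ [[q [sq qp]] _ <-] /=.
    apply: le_trans (sublinear_ge x sq); rewrite lerN2; exact: qp.
  have infV x (q : T) : A q -> inf (V x) <= sval q x.
    by move=> Aq; apply: ge_inf => //; exists q.
  have Vinf x c : (forall q : T, A q -> c <= sval q x) -> c <= inf (V x).
    move=> h; apply: lb_le_inf; first by exists (sval q0 x); exists q0.
    by move=> _ [q Aq <-]; exact: h.
  have Pinf : P (fun x => inf (V x)).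
    split; last by move=> x; apply: le_trans (infV _ _ Aq0) _; case: (q0) => ? [].
    split=> [x y|a x a0].
      rewrite -lerBlDr; apply: (Vinf) => q Aq.
      rewrite lerBlDl -lerBlDr; apply: (Vinf) => r Ar.
      (* Of two members of the chain, the smaller one serves for both [x] and [y]. *)
      rewrite lerBlDl; case: (totA _ _ Aq Ar) => /asboolP qr.
      + apply: le_trans (infV _ _ Ar) _.
        apply: le_trans ((svalP r).1.1 _ _) _.
        by rewrite lerD2r; exact: qr.
      + apply: le_trans (infV _ _ Aq) _.
        apply: le_trans ((svalP q).1.1 _ _) _.
        by rewrite lerD2l; exact: qr.
    rewrite -ler_pdivrMl//; apply: (Vinf) => q Aq.
    rewrite ler_pdivrMl//; apply: le_trans (infV _ _ Aq) _.
    exact: (svalP q).1.2.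
  by exists (exist _ _ Pinf) => s As; apply/asboolP => x; exact: infV.
exists q; have [sq qp] := Pq; split=> // r sr rq.
have Pr : P r by split=> // x; exact: le_trans (rq x) (qp x).
by have := qmin (exist _ r Pr) (introT (asboolP _) rq) => -[].
Qed.

Lemma minimal_sublinear_linear q : sublinear q ->
  (forall r, sublinear r -> (forall x, r x <= q x) -> r = q) ->
  forall (a : R) x y, q (a *: x + y) = a * q x + q y.
Proof.
move=> sq qmin.
have qD x y : q (x + y) = q x + q y.
  apply/eqP; rewrite eq_le sq.1/= -lerBrDr.
  have /(congr1 (@^~ x)) <- :=
    qmin _ (slide_sublinear y sq) (fun z => slide_le_self y z sq).
  by have := @slide_le q y x 1 sq ler01; rewrite scale1r mul1r.
have qN x : q (- x) = - q x.
  by have := qD x (- x); rewrite subrr sublinear0//; lra.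
move=> a x y; rewrite qD; congr (_ + _).
have [a0|/ltW a0] := leP 0 a; first exact: sublinearZ.
by rewrite -[a]opprK scaleNr qN sublinearZ ?oppr_ge0//; lra.
Qed.

(** A minimal functional is taken below [slide] of the norm in direction [x], not just below the
    norm: with [t = 1] this forces [f (- x)] to be at most minus the norm of [x]. *)
Lemma norming_functional x : exists f : E -> R,
  [/\ forall (a : R) y z, f (a *: y + z) = a * f y + f z,
      forall y, `|f y| <= `|y| & f x = `|x|].
Proof.
have sN := norm_sublinear.
have [f [sf fs fmin]] := minimal_sublinear (slide_sublinear x sN).
have flin := minimal_sublinear_linear sf fmin.
have fN y : f (- y) = - f y.
  by rewrite -[- y]addr0 -scaleN1r flin sublinear0//; lra.
have f_le y : f y <= `|y|.
  exact: le_trans (fs _) (slide_le_self _ _ sN).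
exists f; split=> //.
  move=> y; rewrite ler_norml f_le andbT lerNl -fN -[`|y|]normrN; exact: f_le.
apply/eqP; rewrite eq_le f_le /=.
have := fs (- x); rewrite fN.
have := @slide_le _ x (- x) 1 sN ler01.
by rewrite scale1r addNr normr0 mul1r; lra.
Qed.

End HahnBanach.

(** * Weakly convergent sequences are bounded *)

Section RealSequences.
Context {R : realType}.
Implicit Types u v : nat -> R.

Lemma cvg0P u : (u @ \oo --> (0 : R))%classic <->
  forall e : R, 0 < e -> exists N, forall n, (N <= n)%N -> `|u n| < e.
Proof.
split=> [/cvgrPdist_lt h e /h[N _ hN]|h].
  by exists N => n /hN/=; rewrite sub0r normrN.
apply/cvgrPdist_lt => e /h[N hN]; exists N => // n /= Nn.
by rewrite sub0r normrN hN.
Qed.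

Lemma cvg0_approx u :
  (forall e : R, 0 < e -> exists2 v, (v @ \oo --> (0 : R))%classic &
     forall n, `|u n| <= v n + e) ->
  (u @ \oo --> (0 : R))%classic.
Proof.
move=> h; apply/cvg0P => e e0.
have [v /cvg0P/(_ (e / 2)) vcvg uv] := h (e / 2) ltac:(lra).
have [N hN] := vcvg ltac:(lra); exists N => n /hN; have := uv n.
by have := ler_norm (v n); lra.
Qed.

Lemma cvg0_le u v : (forall n, `|u n| <= v n) ->
  (v @ \oo --> (0 : R))%classic -> (u @ \oo --> (0 : R))%classic.
Proof.
move=> uv vcvg; apply: cvg0_approx => e e0; exists v => // n.
by have := uv n; lra.
Qed.

Lemma eq0_geometric (a b c : R) : 0 <= b < 1 ->
  (forall k : nat, `|a| <= c * b ^+ k) -> a = 0.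
Proof.
move=> /andP[b0 b1] h; apply/eqP/negPn/negP; rewrite -normr_gt0 => a0.
have /cvg0P/(_ _ a0)[N /(_ N (leqnn N))] : (geometric c b @ \oo --> (0 : R))%classic.
  by apply: cvg_geometric; rewrite ger0_norm.
by rewrite ltNge => /negP; apply; apply: le_trans (h N) (ler_norm _).
Qed.
End RealSequences.

(** * Continuous functionals and their bounds *)

Section Dual.
Context {R : realType} {E : normedModType R}.
Variable f : E -> R.
Hypothesis df : dual_elt f.

Lemma dual0 : f 0 = 0.
Proof. by have := df.1 1 0 0; rewrite scale1r addr0; lra. Qed.

Lemma dualD x y : f (x + y) = f x + f y.
Proof. by have := df.1 1 x y; rewrite scale1r mul1r. Qed.

Lemma dualZ a x : f (a *: x) = a * f x.
Proof. by have := df.1 a x 0; rewrite !addr0 dual0 addr0. Qed.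

Lemma dualN x : f (- x) = - f x.
Proof. by rewrite -scaleN1r dualZ mulN1r. Qed.

Lemma dual_bounded : exists2 C, 0 <= C & forall x, `|f x| <= C * `|x|.
Proof.
have /cvgrPdist_lt/(_ 1 ltr01) := df.2 0.
rewrite dual0 => /nbhs_ballP[d /= d0 hd].
exists (2 / d) => [|x]; first by rewrite divr_ge0// ltW.
have [->|x0] := eqVneq x 0; first by rewrite dual0 !normr0 mulr0.
have nx0 : 0 < `|x| by rewrite normr_gt0.
(* Rescaled to norm [d / 2], [x] falls into the ball of radius [d] on which [f] has modulus below
   [1]. *)
have {}hd : `|f ((d / 2 / `|x|) *: x)| <= 1.
  apply: ltW; rewrite -[X in X < _]normrN -sub0r; apply: (hd (_ *: x)).
  rewrite -ball_normE /= sub0r normrN normrZ ger0_norm ?divr_ge0// 1?ltW//.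
  by rewrite divfK ?gt_eqF//; lra.
move: hd; rewrite dualZ normrM gtr0_norm ?divr_gt0//.
rewrite -ler_pdivlMl ?divr_gt0// => /le_trans; apply.
by rewrite mulr1 !invf_div mulrC.
Qed.
End Dual.

Lemma dual_elt_of_bound {R : realType} {E : normedModType R} (f : E -> R) (C : R) :
  (forall (a : R) x y, f (a *: x + y) = a * f x + f y) ->
  (forall x, `|f x| <= C * `|x|) -> dual_elt f.
Proof.
move=> flin fC; split=> // x; apply/cvgrPdist_lt => e e0.
(* [C] may be zero or negative, and a positive constant is needed to divide by. *)
have C0 : 0 < `|C| + 1 by rewrite ltr_wpDl.
near=> y.
have -> : f x - f y = f (x - y).
  by have := flin (-1) y x; rewrite scaleN1r addrC => ->; rewrite mulN1r addrC.
apply: le_lt_trans (fC _) _.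
apply: (@le_lt_trans _ _ ((`|C| + 1) * `|x - y|)).
  by rewrite ler_wpM2r//; have := ler_norm C; lra.
rewrite -ltr_pdivlMl//; near: y.
by apply: cvgr_dist_lt => //; rewrite mulr_gt0 ?invr_gt0.
Unshelve. all: by end_near. Qed.

(** * Uniform boundedness *)

Section UniformBoundedness.
Context {R : realType} {E : normedModType R}.

(** The geometric tail from [k] on sums to [3 / 2 * 3^-1 ^+ k]. Adding it, times the norm of [x], to
    [f k x] gives decreasing upper bounds, and subtracting it gives increasing lower bounds; [g x]
    is the infimum of the former. *)
Lemma functional_limit (f : nat -> E -> R) :
  (forall k (a : R) x y, f k (a *: x + y) = a * f k x + f k y) ->
  (forall x, f 0%N x = 0) ->
  (forall k x, `|f k.+1 x - f k x| <= 3^-1 ^+ k * `|x|) ->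
  exists2 g : E -> R, dual_elt g &
    forall k x, `|g x - f k x| <= 3 / 2 * 3^-1 ^+ k * `|x|.
Proof.
move=> flin f0 fstep.
have dec k x : f k.+1 x + 3 / 2 * 3^-1 ^+ k.+1 * `|x| <= f k x + 3 / 2 * 3^-1 ^+ k * `|x|.
  by have := fstep k x; rewrite ler_norml exprS => /andP[_]; lra.
have inc k x : f k x - 3 / 2 * 3^-1 ^+ k * `|x| <= f k.+1 x - 3 / 2 * 3^-1 ^+ k.+1 * `|x|.
  by have := fstep k x; rewrite ler_norml exprS => /andP[+ _]; lra.
have lt_up j k x : f j x - 3 / 2 * 3^-1 ^+ j * `|x| <= f k x + 3 / 2 * 3^-1 ^+ k * `|x|.
  apply: (@le_trans _ _ (f (j + k)%N x - 3 / 2 * 3^-1 ^+ (j + k) * `|x|)).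
    elim: k => [|k IH]; first by rewrite addn0.
    by rewrite addnS; apply: le_trans IH _; exact: inc.
  apply: (@le_trans _ _ (f (j + k)%N x + 3 / 2 * 3^-1 ^+ (j + k) * `|x|)).
    have : 0 <= 3 / 2 * 3^-1 ^+ (j + k) * `|x| by rewrite !mulr_ge0.
    lra.
  elim: j => [|j IH]; first by rewrite add0n.
  by rewrite addSn; apply: le_trans IH; exact: dec.
pose V x := [set f k x + 3 / 2 * 3^-1 ^+ k * `|x| | k in [set: nat]]%classic.
pose g x : R := inf (V x).
have gf k x : `|g x - f k x| <= 3 / 2 * 3^-1 ^+ k * `|x|.
  rewrite ler_distl; apply/andP; split.
    apply: lb_le_inf; first by exists (f 0%N x + 3 / 2 * 3^-1 ^+ 0 * `|x|); exists 0%N.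
    by move=> _ [j _ <-]; exact: lt_up.
  apply: ge_inf; last by exists k.
  by exists (f 0%N x - 3 / 2 * 3^-1 ^+ 0 * `|x|) => _ [j _ <-]; exact: lt_up.
exists g => //; apply: (@dual_elt_of_bound _ _ _ (3 / 2)); last first.
  by move=> x; have := gf 0%N x; rewrite f0 subr0 expr0 mulr1.
(* The defect of linearity of [g] is a combination of the errors [g - f k], hence at most a constant
   times [3^-1 ^+ k] for every [k]. *)
move=> a x y; apply/eqP; rewrite -subr_eq0; apply/eqP.
apply: (@eq0_geometric _ _ 3^-1 (3 / 2 * (`|a *: x + y| + `|a| * `|x| + `|y|))).
  by apply/andP; split; lra.
move=> k.
have -> : g (a *: x + y) - (a * g x + g y) =
  (g (a *: x + y) - f k (a *: x + y)) - a * (g x - f k x) - (g y - f k y).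
  by rewrite flin; ring.
apply: le_trans (ler_normB _ _) _; apply: le_trans (lerD (ler_normB _ _) (lexx _)) _.
rewrite normrM; have := gf k x.
move=> /(ler_wpM2l (normr_ge0 a)).
by have := gf k (a *: x + y); have := gf k y; lra.
Qed.

(* Sokal's gliding hump, on the evaluations [f |-> f (x n)]. *)
Lemma weakly_cvg_bounded (x : nat -> E) (l : E) : weakly_cvg x l -> norm_bounded x.
Proof.
move=> xw; apply: contrapT => unb.
have /choice[n xn] : forall k : nat, exists n, k%:R * 3 ^+ k < `|x n|.
  move=> k; apply: contrapT => h; apply: unb; exists (k%:R * 3 ^+ k) => n.
  by rewrite leNgt; apply/negP => lt; apply: h; exists n.
have /choice[g gP] := fun k => norming_functional (x (n k)).
(* The sign agrees with that of [f (x (n k))], so the added hump does not cancel against the old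
   value. *)
pose step k (f : E -> R) : E -> R := fun y =>
  f y + (if 0 <= f (x (n k)) then 1 else -1) * 3^-1 ^+ k * g k y.
pose f := fix f k := if k is k'.+1 then step k' (f k') else fun=> 0.
have [h dh hf] : exists2 h : E -> R, dual_elt h &
    forall k y, `|h y - f k y| <= 3 / 2 * 3^-1 ^+ k * `|y|.
  apply: functional_limit => //.
  - elim=> [|k IH] a y z /=; first by rewrite mulr0 addr0.
    by rewrite /step IH; have [-> _ _] := gP k; ring.
  - move=> k y; rewrite /= /step addrAC subrr add0r !normrM.
    have -> : `|if 0 <= f k (x (n k)) then 1 else -1 : R| = 1.
      by case: ifP; rewrite ?normrN normr1.
    rewrite mul1r ger0_norm ?exprn_ge0// ler_wpM2l ?exprn_ge0//.
    by have [_ ->] := gP k.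
have [B hB] : exists B, forall n, `|h (x n)| <= B.
  have /cvgP/cvg_seq_bounded[B [_ hB]] := xw _ dh.
  by exists (B + 1) => m; apply: hB => //; rewrite ltrDl.
have hump k : 3^-1 ^+ k * `|x (n k)| <= `|f k.+1 (x (n k))|.
  rewrite /= /step; have [_ _ ->] := gP k.
  have p : 0 <= 3^-1 ^+ k * `|x (n k)| by rewrite mulr_ge0.
  rewrite -mulrA; case: ifPn => [f0|]; first by rewrite ger0_norm; lra.
  by rewrite -ltNge => f0; rewrite ltr0_norm; lra.
(* Later steps alter the value at [x (n k)] by at most [3 / 2 * 3^-1 ^+ k.+1] times its norm, which
   is half of the hump; the other half survives in [h]. *)
have large k : k%:R / 2 <= B.
  apply: le_trans (hB (n k)).
  have : k%:R <= 3^-1 ^+ k * `|x (n k)|.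
    by rewrite exprVn mulrC ler_pdivlMr ?exprn_gt0// ltW.
  have := hump k; have := hf k.+1 (x (n k)); rewrite exprS distrC.
  have := ler_normD (f k.+1 (x (n k)) - h (x (n k))) (h (x (n k))).
  by rewrite subrK; lra.
have B0 : 0 <= B by apply: le_trans (hB 0%N).
have := large (Num.bound (B * 2)); have := @archi_boundP _ (B * 2) ltac:(lra).
lra.
Qed.
End UniformBoundedness.

Lemma bounded_sum_cvg0 {R : realType} (u : nat -> R) (B : R) :
  (forall n, 0 <= u n) -> (forall N, \sum_(0 <= k < N) u k <= B) ->
  (u @ \oo --> (0 : R))%classic.
Proof.
move=> u0 uB; apply: cvg_series_cvg_0; apply: nondecreasing_is_cvgn.
  by apply/nondecreasing_seqP => n; rewrite /series /= big_nat_recr//= lerDl.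
by exists B => _ [n _ <-]; exact: uB.
Qed.

Lemma norm_cvg0_weakly {R : realType} {E : normedModType R} (x : nat -> E) :
  ((fun n => `|x n|) @ \oo --> (0 : R))%classic -> weakly_cvg x 0.
Proof.
move=> x0 f df; rewrite (dual0 df); have [C C0 fC] := dual_bounded df.
apply: (@cvg0_le _ _ (fun n => C * `|x n|)) => //.
by rewrite -(mulr0 C); apply: cvgMr.
Qed.

(** * Banach lattices *)

Section BanachLatticeTheory.
Context {R : realType} {E : normedModType R}.
Variables (le : E -> E -> Prop) (join : E -> E -> E).
Hypothesis BL : banach_lattice le join.
Implicit Types (x y z u v w : E) (a t : R).

Local Notation "x <<= y" := (le x y) (at level 70, no associativity).
Local Notation meet := (meet join).
Local Notation abs := (labs join).
Local Notation pos x := (join x 0).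

Lemma vle_refl x : x <<= x.
Proof. by case: BL. Qed.

Lemma vle_anti x y : x <<= y -> y <<= x -> x = y.
Proof. by case: BL => _ [+ _]; exact. Qed.

Lemma le_tr y x z : x <<= y -> y <<= z -> x <<= z.
Proof. by case: BL => _ [_ [+ _]]; exact. Qed.

Lemma le_addr z x y : x <<= y -> x + z <<= y + z.
Proof. by case: BL => _ [_ [_ [+ _]]]; exact. Qed.

Lemma le_scale a x y : 0 <= a -> x <<= y -> a *: x <<= a *: y.
Proof. by case: BL => _ [_ [_ [_ [+ _]]]]; exact. Qed.

Lemma le_joinl x y : x <<= join x y.
Proof. by case: BL => _ [_ [_ [_ [_ [/(_ x y)[]]]]]]. Qed.

Lemma le_joinr x y : y <<= join x y.
Proof. by case: BL => _ [_ [_ [_ [_ [/(_ x y)[]]]]]]. Qed.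

Lemma join_le x y z : x <<= z -> y <<= z -> join x y <<= z.
Proof. by case: BL => _ [_ [_ [_ [_ [_ [+ _]]]]]]; exact. Qed.

Lemma norm_le_abs x y : abs x <<= abs y -> `|x| <= `|y|.
Proof. by case: BL => _ [_ [_ [_ [_ [_ [_ +]]]]]]; exact. Qed.

Lemma le_add x y z w : x <<= y -> z <<= w -> x + z <<= y + w.
Proof.
move=> xy zw; apply: le_tr (le_addr z xy) _; rewrite ![y + _]addrC.
exact: le_addr.
Qed.

Lemma le_subl x y z : x <<= y + z -> x - z <<= y.
Proof. by move=> /(le_addr (- z)); rewrite addrK. Qed.

Lemma le_subr x y z : x - z <<= y -> x <<= y + z.
Proof. by move=> /(le_addr z); rewrite subrK. Qed.

Lemma le_opp x y : x <<= y -> - y <<= - x.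
Proof.
move=> xy; have := le_addr (- x - y) xy.
by rewrite addrA subrr add0r addrCA subrr addr0.
Qed.

Lemma le_sub_ge0 x y : x <<= y -> 0 <<= y - x.
Proof. by move=> /(le_addr (- x)); rewrite subrr. Qed.

Lemma add_nneg x y : 0 <<= x -> 0 <<= y -> 0 <<= x + y.
Proof. by move=> x0 y0; have := le_add x0 y0; rewrite addr0. Qed.

Lemma scale_nneg a x : 0 <= a -> 0 <<= x -> 0 <<= a *: x.
Proof. by move=> a0 /(le_scale a0); rewrite scaler0. Qed.

Lemma le_addr_nneg x y : 0 <<= y -> x <<= x + y.
Proof. by move=> /(le_add (vle_refl x)); rewrite addr0. Qed.

Lemma le_sub_nneg x y : 0 <<= y -> x - y <<= x.
Proof. by move=> y0; apply: le_subl; exact: le_addr_nneg. Qed.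

Lemma meet_lel x y : meet x y <<= x.
Proof. by have := le_opp (le_joinl (- x) (- y)); rewrite opprK. Qed.

Lemma meet_ler x y : meet x y <<= y.
Proof. by have := le_opp (le_joinr (- x) (- y)); rewrite opprK. Qed.

Lemma le_meet z x y : z <<= x -> z <<= y -> z <<= meet x y.
Proof.
move=> /le_opp zx /le_opp zy.
by have := le_opp (join_le zx zy); rewrite opprK.
Qed.

Lemma meet_le x y x' y' : x <<= x' -> y <<= y' -> meet x y <<= meet x' y'.
Proof.
move=> xx yy; apply: le_meet; first exact: le_tr (meet_lel _ _) xx.
exact: le_tr (meet_ler _ _) yy.
Qed.

Lemma le_abs x : x <<= abs x. Proof. exact: le_joinl. Qed.
Lemma le_absN x : - x <<= abs x. Proof. exact: le_joinr. Qed.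

(** Adding [x <<= abs x] and [- x <<= abs x] gives twice the claim. *)
Lemma abs_ge0 x : 0 <<= abs x.
Proof.
have := le_add (le_abs x) (le_absN x); rewrite subrr.
have h : 0 <= 2^-1 :> R by lra.
move=> /(scale_nneg h).
have e : 2^-1 + 2^-1 = 1 :> R by lra.
by rewrite scalerDr -scalerDl e scale1r.
Qed.

Lemma abs_id x : 0 <<= x -> abs x = x.
Proof.
move=> x0; apply: vle_anti; last exact: le_abs.
by apply: join_le; [exact: vle_refl|have := le_opp x0; rewrite oppr0 => /le_tr; apply].
Qed.

Lemma norm_abs x : `|abs x| = `|x|.
Proof.
have aa := abs_id (abs_ge0 x).
by apply/eqP; rewrite eq_le !norm_le_abs// aa; exact: vle_refl.
Qed.

Lemma norm_le x y : abs x <<= y -> `|x| <= `|y|.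
Proof.
move=> xy; apply: norm_le_abs; rewrite (@abs_id y)//.
exact: le_tr (abs_ge0 x) xy.
Qed.

Lemma norm_le_nneg x y : 0 <<= x -> x <<= y -> `|x| <= `|y|.
Proof. by move=> x0 xy; apply: norm_le; rewrite abs_id. Qed.

(** * Positive parts, disjointness and Riesz decomposition *)

Lemma pos_ge0 x : 0 <<= pos x. Proof. exact: le_joinr. Qed.
Lemma le_pos x : x <<= pos x. Proof. exact: le_joinl. Qed.

Lemma posN x : pos (- x) = pos x - x.
Proof.
have aux y : pos y - y <<= pos (- y).
  apply: le_subl; apply: join_le; rewrite addrC.
    by apply: le_addr_nneg; exact: pos_ge0.
  by rewrite addrC; have := le_add (le_pos (- y)) (vle_refl y); rewrite addNr.
apply: vle_anti => //; apply: join_le.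
  by have := le_addr (- x) (pos_ge0 x); rewrite add0r.
exact: le_sub_ge0 (le_pos x).
Qed.

Lemma pos_posN x : pos x - pos (- x) = x.
Proof. by rewrite posN opprB addrC subrK. Qed.

Lemma pos_le_abs x : pos x <<= abs x.
Proof. by apply: join_le; [exact: le_abs|exact: abs_ge0]. Qed.

Lemma abs_le_pos x : abs x <<= pos x + pos (- x).
Proof.
apply: join_le; first exact: le_tr (le_pos x) (le_addr_nneg _ (pos_ge0 _)).
apply: le_tr (le_pos (- x)) _; rewrite addrC; exact: le_addr_nneg (pos_ge0 _).
Qed.

Lemma norm_pos_le x : `|pos x| <= `|x|.
Proof. by rewrite -(norm_abs x) norm_le_nneg//; [exact: pos_ge0|exact: pos_le_abs]. Qed.

(** [pos x - z] dominates both [x] and [0], hence [pos x]. *)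
Lemma pos_disjoint x z : z <<= pos x -> z <<= pos (- x) -> z <<= 0.
Proof.
rewrite posN => zx zNx.
have : pos x <<= pos x - z.
  apply: join_le; last exact: le_sub_ge0.
  by have := le_add zNx (vle_refl (x - z)); rewrite addrCA subrr addr0 addrA subrK.
by move=> /le_opp/(le_add (vle_refl (pos x))); rewrite subrr opprB addrCA subrr addr0.
Qed.

(** With [m] the left side, both [m - x] and [m - y] lie below [meet x z], hence so does
    [m - meet x y]. *)
Lemma meet_addr_le x y z : 0 <<= x -> 0 <<= y -> 0 <<= z ->
  meet x (y + z) <<= meet x y + meet x z.
Proof.
move=> x0 y0 z0; rewrite [X in _ <<= X]addrC; apply: le_subr; set m := meet x (y + z).
have mx : m <<= x by exact: meet_lel.
have h u : m - u <<= meet x z -> - u <<= meet x z - m.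
  by move=> /(le_addr (- m)); rewrite addrAC subrr add0r.
have : join (- x) (- y) <<= meet x z - m.
  apply: join_le; apply: h; apply: le_meet.
  - exact: le_tr (le_sub_nneg _ x0) mx.
  - by apply: le_tr z0; apply: le_subl; rewrite add0r.
  - exact: le_tr (le_sub_nneg _ y0) mx.
  - by apply: le_subl; rewrite addrC; exact: meet_ler.
move=> /(le_addr m); rewrite subrK -[join _ _]opprK addrC; exact.
Qed.

(** The pieces are [meet z x] and the rest, which is below [y] because meets are subadditive. *)
Lemma riesz_decomposition x y z : 0 <<= x -> 0 <<= y -> 0 <<= z -> z <<= x + y ->
  exists z1 z2, [/\ z = z1 + z2, 0 <<= z1 /\ z1 <<= x & 0 <<= z2 /\ z2 <<= y].
Proof.
move=> x0 y0 z0 zxy; exists (meet z x), (z - meet z x); split.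
- by rewrite addrC subrK.
- by split; [exact: le_meet|exact: meet_ler].
- split; first by apply: le_sub_ge0; exact: meet_lel.
  apply: le_subl; apply: le_tr (_ : _ <<= meet z (x + y)) _; first exact: le_meet (vle_refl _) _.
  apply: le_tr (meet_addr_le z0 x0 y0) _; rewrite addrC; apply: le_addr.
  exact: meet_ler.
Qed.

(** [x + y - u] lies below both [x] and [y]: only their overlap can exceed the bound [u]. *)
Lemma add_le_of_meet x y u v : x <<= u -> y <<= u -> meet x y <<= v -> x + y <<= u + v.
Proof.
move=> xu yu mv; rewrite [u + v]addrC; apply: le_subr; apply: le_tr mv.
apply: le_meet; apply: le_subl; first exact: le_add (vle_refl x) yu.
by rewrite addrC; exact: le_add (vle_refl y) xu.
Qed.

(* With [p] and [q] the disjoint positive and negative parts of [y - t x],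
   [t z - y <= q] and [t z - y <= t p]. *)
Lemma almost_disjoint t x y z : 1 <= t -> 0 <<= y ->
  z <<= pos (y - t *: x) -> z <<= x -> t *: z <<= y.
Proof.
move=> t1 y0 zp zx; have t0 : 0 < t by lra.
have s0 : 0 <= t^-1 by rewrite invr_ge0 ltW.
set d := t *: z - y.
have dz : t^-1 *: d <<= z.
  rewrite -[X in _ <<= X](scalerK (lt0r_neq0 t0)); apply: le_scale s0 _.
  exact: le_sub_nneg.
have dq : t^-1 *: d <<= pos (- (y - t *: x)).
  rewrite opprB; set q := pos _; have q0 : 0 <<= q by exact: pos_ge0.
  (* [1 <= t] enters here, through [t^-1 *: q <<= q]. *)
  apply: le_tr (_ : t^-1 *: q <<= q).
    apply: le_scale s0 _; apply: le_tr (le_pos _); apply: le_addr.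
    by apply: le_scale (ltW t0) _.
  rewrite -[X in _ <<= X](subrK (t^-1 *: q)) addrC; apply: le_addr_nneg.
  by rewrite -[X in X - _]scale1r -scalerBl; apply: scale_nneg => //; rewrite subr_ge0 invf_le1.
have := pos_disjoint (le_tr dz zp) dq.
move=> /(le_scale (ltW t0)); rewrite scalerA mulfV ?gt_eqF// scale1r scaler0.
by move=> /(le_addr y); rewrite subrK add0r.
Qed.

(** * Functionals determined on the positive cone *)

Section PositiveExtension.
Variables (P : E -> R) (C : R).
Hypothesis PD : forall x y, 0 <<= x -> 0 <<= y -> P (x + y) = P x + P y.
Hypothesis PZ : forall a x, 0 < a -> 0 <<= x -> P (a *: x) = a * P x.
Hypothesis PC : forall x, 0 <<= x -> `|P x| <= C * `|x|.

(** [P (pos x) - P (pos (- x))] keeps its value when [x] is written as any other difference of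
    positive elements, which gives linearity. *)
Lemma cone_extension : exists2 g, dual_elt g & forall x, 0 <<= x -> g x = P x.
Proof.
pose g x := P (pos x) - P (pos (- x)).
have gE x u v : 0 <<= u -> 0 <<= v -> x = u - v -> g x = P u - P v.
  move=> u0 v0 xuv; have p0 := pos_ge0 x; have q0 := pos_ge0 (- x).
  have /(congr1 P) : pos x + v = u + pos (- x).
    by apply/eqP; rewrite -subr_eq -addrA [v - _]addrC addrA pos_posN xuv subrK.
  by rewrite !PD// /g; lra.
have P0 : P 0 = 0.
  by have := PD (vle_refl 0) (vle_refl 0); rewrite addr0; lra.
have gP x : 0 <<= x -> g x = P x.
  by move=> x0; rewrite (gE x x 0)// ?subr0 ?P0 ?subr0//; exact: vle_refl.
have gN x : g (- x) = - g x by rewrite /g opprK opprB.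
have gD x y : g (x + y) = g x + g y.
  rewrite (gE (x + y) (pos x + pos y) (pos (- x) + pos (- y))); last 1 first.
  - by rewrite opprD addrACA !pos_posN.
  - by rewrite !PD; try exact: pos_ge0; rewrite /g; lra.
  - by apply: add_nneg; exact: pos_ge0.
  - by apply: add_nneg; exact: pos_ge0.
have gZ a x : 0 < a -> g (a *: x) = a * g x.
  move=> a0; rewrite (gE _ (a *: pos x) (a *: pos (- x))).
  - by rewrite !PZ// /g ?mulrBr//; exact: pos_ge0.
  - by apply: scale_nneg (ltW a0) (pos_ge0 _).
  - by apply: scale_nneg (ltW a0) (pos_ge0 _).
  - by rewrite -scalerBr pos_posN.
exists g => //; apply: (@dual_elt_of_bound _ _ _ (2 * `|C|)).
  move=> a x y; rewrite gD; congr (_ + _).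
  have [a0|a0|<-] := ltgtP 0 a; first exact: gZ.
    by rewrite -[a]opprK scaleNr gN gZ ?oppr_gt0// !mulNr.
  by rewrite scale0r mul0r gP//; exact: vle_refl.
move=> x; apply: le_trans (ler_normB _ _) _.
have b y : `|P (pos y)| <= `|C| * `|y|.
  apply: le_trans (PC (pos_ge0 y)) _; apply: le_trans (ler_norm _) _.
  by rewrite normrM normr_id ler_wpM2l// norm_pos_le.
by have := b x; have := b (- x); rewrite normrN; lra.
Qed.
End PositiveExtension.

(* The Riesz-Kantorovich formula, with the supremum restricted to a face [K] of
   the positive cone: [K] the whole cone gives the positive part of [f], and
   [K] the ray of an atom gives the coordinate along that atom. *)
Lemma face_sup_functional (f : E -> R) (K : E -> Prop) : dual_elt f ->
  K 0 -> (forall x y, K x -> K y -> K (x + y)) ->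
  (forall a x, 0 < a -> K x -> K (a *: x)) ->
  (forall x y, 0 <<= x -> x <<= y -> K y -> K x) ->
  exists g, [/\ dual_elt g,
    forall x y, 0 <<= y -> y <<= x -> K y -> f y <= g x &
    forall x c, 0 <<= x -> (forall y, 0 <<= y -> y <<= x -> K y -> f y <= c) -> g x <= c].
Proof.
move=> df K0 KD KZ Kface; have [C C0 fC] := dual_bounded df.
pose V x := [set f y | y in [set y | [/\ 0 <<= y, y <<= x & K y]]]%classic.
pose P x := sup (V x).
have ubV x : has_ubound (V x).
  exists (C * `|x|) => _ [y [y0 yx _] <-]; apply: le_trans (ler_norm _) _.
  by apply: le_trans (fC y) _; rewrite ler_wpM2l// norm_le_nneg.
have Pge x y : 0 <<= y -> y <<= x -> K y -> f y <= P x.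
  by move=> y0 yx Ky; apply: ub_le_sup => //; exists y.
have Ple x c : 0 <<= x -> (forall y, 0 <<= y -> y <<= x -> K y -> f y <= c) -> P x <= c.
  move=> x0 h; apply: ge_sup; last by move=> _ [y [y0 yx Ky] <-]; exact: h.
  by exists (f 0), 0 => //; split=> //; exact: vle_refl.
have P_ge0 x : 0 <<= x -> 0 <= P x.
  by move=> x0; rewrite -(dual0 df); apply: (Pge) => //; exact: vle_refl.
have PD x y : 0 <<= x -> 0 <<= y -> P (x + y) = P x + P y.
  move=> x0 y0; apply/eqP; rewrite eq_le; apply/andP; split.
    apply: (Ple); first exact: add_nneg.
    (* The pieces of the Riesz decomposition lie below [z], so they stay in the face [K]. *)
    move=> z z0 zxy Kz; have [z1 [z2 [zE [z10 z1x] [z20 z2y]]]] := riesz_decomposition x0 y0 z0 zxy.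
    rewrite zE (dualD df); apply: lerD; apply: (Pge) => //; apply: (Kface _ z) => //; rewrite zE.
      exact: le_addr_nneg.
    by rewrite addrC; exact: le_addr_nneg.
  rewrite -lerBrDr; apply: (Ple) => // z z0 zx Kz.
  rewrite lerBrDr -lerBrDl; apply: (Ple) => // w w0 wy Kw.
  rewrite lerBrDl -(dualD df); apply: (Pge); [exact: add_nneg|exact: le_add|exact: KD].
have PZ_le a x : 0 < a -> 0 <<= x -> P (a *: x) <= a * P x.
  move=> a0 x0; apply: (Ple); first exact: scale_nneg (ltW a0) x0.
  move=> y y0 yax Ky; have ai : 0 < a^-1 by rewrite invr_gt0.
  rewrite -ler_pdivrMl// -(dualZ df); apply: (Pge).
  - exact: scale_nneg (ltW ai) y0.
  - by have := le_scale (ltW ai) yax; rewrite scalerK ?gt_eqF.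
  - exact: KZ.
have PZ a x : 0 < a -> 0 <<= x -> P (a *: x) = a * P x.
  move=> a0 x0; apply/eqP; rewrite eq_le PZ_le//= -ler_pdivlMl//.
  rewrite -{1}[x](scalerK (lt0r_neq0 a0)); apply: PZ_le; first by rewrite invr_gt0.
  exact: scale_nneg (ltW a0) x0.
have PC x : 0 <<= x -> `|P x| <= C * `|x|.
  move=> x0; rewrite ger0_norm ?P_ge0//; apply: (Ple) => // y y0 yx _.
  apply: le_trans (ler_norm _) _; apply: le_trans (fC y) _.
  by rewrite ler_wpM2l// norm_le_nneg.
have [g dg gP] := cone_extension PD PZ PC.
exists g; split=> // [x y y0 yx|x c x0]; first by rewrite gP; [exact: Pge|exact: le_tr yx].
by rewrite gP//; exact: Ple.
Qed.

(** With [g] and [h] the positive parts of [f] and [- f], [f (x n)] lies between [- h (y n)] and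
    [g (y n)]. *)
Lemma weakly_null_le (x y : nat -> E) : (forall n, 0 <<= x n) ->
  (forall n, x n <<= y n) -> weakly_cvg y 0 -> weakly_cvg x 0.
Proof.
move=> x0 xy y0; suff key f : dual_elt f ->
    exists2 g, dual_elt g & forall n, f (x n) <= g (y n).
  move=> f df; rewrite (dual0 df); have [g dg fg] := key f df.
  have dNf : dual_elt (fun z => - f z).
    by split=> [a u v|]; [rewrite df.1; ring|move=> z; apply: cvgN; exact: df.2].
  have [h dh fh] := key _ dNf.
  apply: (@cvg0_le _ _ (fun n => `|g (y n)| + `|h (y n)|)) => [n|].
    have := fg n; have := fh n; have := ler_norm (g (y n)); have := ler_norm (h (y n)).
    by have := normr_ge0 (g (y n)); have := normr_ge0 (h (y n)); rewrite ler_norml; lra.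
  rewrite -[X in (_ --> X)%classic]addr0 -[X in (_ --> X + _)%classic](normr0 R).
  rewrite -[X in (_ --> _ + X)%classic](normr0 R).
  apply: cvgD; apply: cvg_norm; [rewrite -(dual0 dg); exact: y0|rewrite -(dual0 dh); exact: y0].
move=> df; have [//|//|//|//|g [dg gf _]] :=
  @face_sup_functional f (fun=> True) df.
by exists g => // n; exact: gf.
Qed.

(** * Weakly null sequences and atoms *)

Lemma wsc_uaw_null (x : nat -> E) : wsc_lattice_ops join ->
  weakly_cvg x 0 -> uaw_cvg le join x 0.
Proof.
move=> wsc /wsc x0 u u0; apply: weakly_null_le x0 => n; rewrite subr0.
  by apply: le_meet => //; exact: abs_ge0.
exact: meet_lel.
Qed.

(** Scaling by [t^-1] puts [x] below [a], so [x] is a multiple of [a]. The definition of an atom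
    leaves the sign of the coefficient open; a negative one would give [a <<= 0]. *)
Lemma ray_face (a x y : E) : atom le a -> 0 <<= x -> x <<= y ->
  (exists2 t : R, 0 <= t & y = t *: a) -> exists2 t : R, 0 <= t & x = t *: a.
Proof.
move=> [[a0 aN0] aP] x0 xy [t]; rewrite le_eqVlt => /predU1P[<-|t0] yE.
  exists 0 => //; rewrite scale0r; apply: vle_anti => //.
  by have := xy; rewrite yE scale0r.
have ti : 0 <= t^-1 by rewrite invr_ge0 ltW.
have := le_scale ti xy; rewrite yE scalerK ?gt_eqF// => /aP[|l lE].
  exact: scale_nneg.
have xE : x = (t * l) *: a by rewrite -scalerA -lE scalerKV ?gt_eqF.
exists (t * l) => //; rewrite leNgt; apply/negP => tl.
apply: aN0; apply: vle_anti => //.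
have tl0 : 0 <= - (t * l)^-1 by rewrite oppr_ge0 invr_le0 ltW.
have := scale_nneg tl0 x0; rewrite xE scaleNr scalerK ?lt_eqF//.
by move=> /le_opp; rewrite opprK oppr0.
Qed.

(* The coordinate functional [g] along the atom [a] satisfies [g |x| <= |g x|],
   since one of [g x^+], [g x^-] vanishes. *)
Lemma atom_functional (a : E) : atom le a -> exists2 g : E -> R, dual_elt g &
  forall x t, 0 <= t -> t *: a <<= abs x -> t * `|a| <= `|g x|.
Proof.
move=> ata; have [[a0 aN0] _] := ata.
have [f [flin fC fa]] := norming_functional a.
have df : dual_elt f by apply: (@dual_elt_of_bound _ _ f 1) => // x; rewrite mul1r.
pose K y := exists2 t : R, 0 <= t & y = t *: a.
have [||||g [dg gge gle]] := @face_sup_functional f K df.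
- by exists 0; rewrite ?scale0r.
- move=> _ _ [s s0 ->] [t t0 ->]; exists (s + t); rewrite ?addr_ge0//.
  by rewrite scalerDl.
- move=> t _ t0 [s s0 ->]; exists (t * s); rewrite ?scalerA//.
  by rewrite mulr_ge0// ltW.
- by move=> x y x0 xy; exact: ray_face.
have g_ge0 x : 0 <<= x -> 0 <= g x.
  move=> x0; rewrite -(dual0 df); apply: gge => //; first exact: vle_refl.
  by exists 0; rewrite ?scale0r.
(* Without such a multiple, [0] is the only element of the ray below [x], and the supremum [g x] is
   at most [0]. *)
have gpos x : 0 < g x -> 0 <<= x -> exists2 t : R, 0 < t & t *: a <<= x.
  move=> gx0 x0; apply: contrapT => h; suff : g x <= 0 by rewrite leNgt gx0.
  apply: gle => // y y0 yx [t t0 tE]; have tax : t *: a <<= x by rewrite -tE.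
  rewrite tE.
  have [->|tN0] := eqVneq t 0; first by rewrite scale0r (dual0 df).
  by exfalso; apply: h; exists t => //; rewrite lt0r tN0.
exists g => // x t t0 tax.
have p0 := g_ge0 _ (pos_ge0 x); have q0 := g_ge0 _ (pos_ge0 (- x)).
have disj : g (pos x) = 0 \/ g (pos (- x)) = 0.
  have [|p1] := leP (g (pos x)) 0; first by left; lra.
  have [|q1] := leP (g (pos (- x))) 0; first by right; lra.
  have [s s0 sx] := gpos _ p1 (pos_ge0 _); have [r r0 rx] := gpos _ q1 (pos_ge0 _).
  exfalso; apply: aN0; apply: vle_anti => //.
  (* The smaller of the two multiples of [a] is below both [pos x] and [pos (- x)], against
     disjointness. *)
  pose m := Num.min s r; have m0 : 0 < m by rewrite lt_min s0.
  have ml c : m <= c -> m *: a <<= c *: a.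
    move=> mc; rewrite -[c](subrK m) scalerDl addrC; apply: le_addr_nneg.
    by apply: scale_nneg => //; rewrite subr_ge0.
  have : m *: a <<= 0.
    apply: (@pos_disjoint x).
      by apply: le_tr sx; apply: ml; rewrite ge_min lexx.
    by apply: le_tr rx; apply: ml; rewrite ge_min lexx orbT.
  have mi : 0 <= m^-1 by rewrite invr_ge0 ltW.
  by move=> /(le_scale mi); rewrite scalerK ?gt_eqF// scaler0.
have : t * f a <= g (pos x + pos (- x)).
  rewrite -(dualZ df); apply: gge; last by exists t.
    exact: scale_nneg.
  exact: le_tr tax (abs_le_pos x).
rewrite fa (dualD dg) => /le_trans; apply.
have -> : g x = g (pos x) - g (pos (- x)).
  by rewrite -[in LHS](pos_posN x) (dualD dg) (dualN dg).
by case: disj => ->; rewrite ?add0r ?sub0r ?addr0 ?subr0 ?normrN ger0_norm.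
Qed.

(** The meet lies on the ray of [a], so it is some [t *: a] below [abs (y n)], and the coordinate
    [g] controls its norm. *)
Lemma atom_meet_null (y : nat -> E) (a : E) : weakly_cvg y 0 -> atom le a ->
  ((fun n => `|meet (abs (y n)) a|) @ \oo --> (0 : R))%classic.
Proof.
move=> y0 ata; have [[a0 _] _] := ata; have [g dg ga] := atom_functional ata.
apply: (@cvg0_le _ _ (fun n => `|g (y n)|)) => [n|]; last first.
  by rewrite -(normr0 R); apply: cvg_norm; rewrite -(dual0 dg); exact: y0.
have m0 : 0 <<= meet (abs (y n)) a by apply: le_meet => //; exact: abs_ge0.
have [|t t0 mE] := ray_face ata m0 (meet_ler _ _).
  by exists 1; rewrite ?scale1r.
rewrite normr_id mE normrZ ger0_norm//; apply: ga => //.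
by rewrite -mE; exact: meet_lel.
Qed.

(** * Meets with a fixed element *)

Lemma meet_abs_ge0 (x u : E) : 0 <<= u -> 0 <<= meet (abs x) u.
Proof. by move=> u0; apply: le_meet => //; exact: abs_ge0. Qed.

Lemma norm_meet_add (x u v : E) : 0 <<= u -> 0 <<= v ->
  `|meet (abs x) (u + v)| <= `|meet (abs x) u| + `|meet (abs x) v|.
Proof.
move=> u0 v0; apply: le_trans (ler_normD _ _).
apply: norm_le_nneg; first by apply: meet_abs_ge0; exact: add_nneg.
by apply: meet_addr_le => //; exact: abs_ge0.
Qed.

(* Order continuity is applied to the upward directed set of those [w] in
   [[0, v]] for which the conclusion holds. It contains [w + a] whenever [a] is
   an atom with [w + a <= v], so its supremum is [v]. *)
Lemma discrete_meet_null (y : nat -> E) v :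
  discrete le -> order_continuous_norm le -> weakly_cvg y 0 -> 0 <<= v ->
  ((fun n => `|meet (abs (y n)) v|) @ \oo --> (0 : R))%classic.
Proof.
move=> dis oc y0 v0.
pose W w := 0 <<= w /\ ((fun n => `|meet (abs (y n)) w|) @ \oo --> (0 : R))%classic.
have WD w w' : W w -> W w' -> W (w + w').
  move=> [w0 Ww] [w'0 Ww']; split; first exact: add_nneg.
  apply: (@cvg0_le _ _ (fun n => `|meet (abs (y n)) w| + `|meet (abs (y n)) w'|)) => [n|].
    by rewrite normr_id; exact: norm_meet_add.
  by rewrite -[X in (_ --> X)%classic](addr0 (0 : R)); exact: cvgD.
have Wle w w' : 0 <<= w -> w <<= w' -> W w' -> W w.
  move=> w0 ww' [w'0 Ww']; split=> //; apply: cvg0_le Ww' => n.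
  rewrite normr_id; apply: norm_le_nneg; first exact: meet_abs_ge0.
  by apply: meet_le => //; exact: vle_refl.
have W0 : W 0.
  split; first exact: vle_refl.
  apply: (@cvg0_le _ _ (fun=> 0)) => [n|]; last exact: cvg_cst.
  rewrite normr_id -(normr0 E); apply: norm_le_nneg; last exact: meet_ler.
  by apply: meet_abs_ge0; exact: vle_refl.
pose I := {w : E | W w /\ w <<= v}.
pose leI (i j : I) := sval i <<= sval j.
have dir i j : exists k, leI i k /\ leI j k.
  case: i j => [w [Ww wv]] [w' [Ww' w'v]].
  (* The join is below the sum, so directedness follows from closure under sums. *)
  have Wj : W (join w w') /\ join w w' <<= v.
    split; last exact: join_le.
    apply: Wle (WD _ _ Ww Ww'); first exact: le_tr (proj1 Ww) (le_joinl _ _).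
    apply: join_le; first exact: le_addr_nneg (proj1 Ww').
    by rewrite addrC; exact: le_addr_nneg (proj1 Ww).
  by exists (exist (fun w => W w /\ w <<= v) _ Wj); split; [exact: le_joinl|exact: le_joinr].
have inf0 z : (forall i : I, z <<= v - sval i) -> z <<= 0.
  move=> zle; apply: contrapT => zN0.
  have [|a [ata aps]] := dis (pos z).
    split; first exact: pos_ge0.
    by move=> z0; apply: zN0; rewrite z0; exact: le_pos.
  have Wa : W a by split; [case: ata => -[]|exact: atom_meet_null].
  (* A lower bound [z] always leaves room for one more [a], so all multiples of [a] stay below [v],
     which their growing norms forbid. *)
  have iter n : W (a *+ n) /\ a *+ n <<= v.
    elim: n => [|n [Wn nv]]; first by rewrite mulr0n.
    rewrite mulrS; split; first exact: WD.
    have zv : z <<= v - a *+ n.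
      exact: zle (exist (fun w => W w /\ w <<= v) _ (conj Wn nv)).
    have /(le_addr (a *+ n)) := le_tr aps (join_le zv (le_sub_ge0 nv)).
    by rewrite subrK.
  have a0 : 0 < `|a|.
    by rewrite normr_gt0; apply/eqP => ae; case: ata => -[_]; rewrite ae.
  have large n : n%:R <= `|v| / `|a|.
    rewrite ler_pdivlMr// mulr_natl -normrMn.
    by case: (iter n) => -[an0 _] anv; exact: norm_le_nneg.
  have va : 0 <= `|v| / `|a| by rewrite divr_ge0.
  by have := large (Num.bound (`|v| / `|a|)); rewrite leNgt archi_boundP.
apply: cvg0_approx => e e0.
have [[w [[w0 Ww] wv]] wlt] : exists i0 : I, forall i, leI i0 i -> `|v - sval i| < e.
  apply: (oc I leI (fun i => v - sval i)) e0 => //.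
  - by exists (exist (fun w => W w /\ w <<= v) _ (conj W0 v0)).
  - by move=> i; exact: vle_refl.
  - by move=> i j k; exact: le_tr.
  - by move=> i j ij; rewrite ![v - _]addrC; apply: le_addr; exact: le_opp.
  - by move=> [w [Ww wv]]; exact: le_sub_ge0.
have {}wlt := wlt _ (vle_refl _); rewrite /= in wlt.
exists (fun n => `|meet (abs (y n)) w|) => // n.
rewrite normr_id; have vw : 0 <<= v - w by exact: le_sub_ge0.
have := norm_meet_add (y n) w0 vw; rewrite addrC subrK => /le_trans; apply.
rewrite lerD2l; apply: le_trans (ltW wlt).
by apply: norm_le_nneg; [exact: meet_abs_ge0|exact: meet_ler].
Qed.

(* If [x_n = w_n /\ u], then [x_0 + ... + x_(N-1) <= u + sum_(n < N) 2^-n y_n]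
   stays norm bounded, so [sum_n |f x_n|] converges for every functional [f]. *)
Lemma truncated_tails_uaw_null (y s w : nat -> E) (M : R) :
  (forall n, 0 <<= y n) -> (forall n, `|y n| <= M) ->
  s 0%N = 0 -> (forall n, s n.+1 = s n + y n) ->
  (forall n, w n = pos (y n - 2 ^+ n *: s n)) -> uaw_cvg le join w 0.
Proof.
move=> y0 yM s0 sS wE u u0.
pose x n := meet (abs (w n - 0)) u.
rewrite -/x.
have wx n : x n <<= w n.
  by rewrite /x subr0 abs_id//; [exact: meet_lel|rewrite wE; exact: pos_ge0].
have x0 n : 0 <<= x n by exact: meet_abs_ge0.
have xu n : x n <<= u by exact: meet_ler.
pose S N := \sum_(0 <= n < N) x n.
pose Q N := \sum_(0 <= n < N) 2^-1 ^+ n *: y n.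
have SS N : S N.+1 = S N + x N by rewrite /S big_nat_recr.
have QS N : Q N.+1 = Q N + 2^-1 ^+ N *: y N by rewrite /Q big_nat_recr.
have s_ge0 N : 0 <<= s N.
  elim: N => [|N IH]; first by rewrite s0; exact: vle_refl.
  by rewrite sS; exact: add_nneg.
have wy n : w n <<= y n.
  rewrite wE; apply: join_le => //; apply: le_sub_nneg.
  by apply: scale_nneg => //; rewrite exprn_ge0.
have Q0 N : 0 <<= Q N.
  elim: N => [|N IH]; first by rewrite /Q big_geq//; exact: vle_refl.
  by rewrite QS; apply: add_nneg => //; apply: scale_nneg => //; rewrite exprn_ge0.
have S0 N : 0 <<= S N.
  elim: N => [|N IH]; first by rewrite /S big_geq//; exact: vle_refl.
  by rewrite SS; exact: add_nneg.
have Ss N : S N <<= s N.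
  elim: N => [|N IH]; first by rewrite /S big_geq// s0; exact: vle_refl.
  by rewrite SS sS; apply: le_add => //; exact: le_tr (wx N) (wy N).
(* By [add_le_of_meet] only the overlap of [S N] with [x N] adds to the bound. It is below [s N] and
   [w N], so [almost_disjoint] with factor [2 ^+ N] puts it below [2^-1 ^+ N *: y N]. *)
have SQ N : S N <<= u + Q N.
  elim: N => [|N IH]; first by rewrite /S /Q !big_geq// addr0.
  rewrite SS QS addrA; apply: add_le_of_meet => //.
    exact: le_tr (xu N) (le_addr_nneg _ (Q0 N)).
  have tN : 1 <= 2 ^+ N :> R by rewrite exprn_ege1// ler1n.
  set z := meet _ _.
  have : 2 ^+ N *: z <<= y N.
    apply: (@almost_disjoint _ (s N)) => //.
      by rewrite -wE; exact: le_tr (meet_ler _ _) (wx N).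
    exact: le_tr (meet_lel _ _) (Ss N).
  have ti : 0 <= 2^-1 ^+ N :> R by rewrite exprn_ge0.
  move=> /(le_scale ti); rewrite scalerA -exprMn mulVf// ?expr1n ?scale1r//.
(* The factor of [M] is the partial sum of the weights [2^-1 ^+ n]. *)
have Qn N : `|Q N| <= M * (2 - 2 * 2^-1 ^+ N).
  elim: N => [|N IH]; first by rewrite /Q big_geq// normr0 expr0 mulr1 subrr mulr0.
  rewrite QS; apply: le_trans (ler_normD _ _) _; rewrite normrZ ger0_norm ?exprn_ge0//.
  have := ler_wpM2l (exprn_ge0 N (_ : 0 <= 2^-1 :> R)) (yM N).
  by move=> /(_ ltac:(lra)); rewrite exprS; lra.
have M0 : 0 <= M by apply: le_trans (yM 0%N).
have Sn N : `|S N| <= `|u| + 2 * M.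
  apply: le_trans (norm_le_nneg (S0 N) (SQ N)) _.
  apply: le_trans (ler_normD _ _) _; rewrite lerD2l; apply: le_trans (Qn N) _.
  rewrite mulrC ler_wpM2r// lerBlDr lerDl mulr_ge0// exprn_ge0//.
move=> f df; rewrite (dual0 df); have [C C0 fC] := dual_bounded df.
apply: (@cvg0_le _ _ (fun n => `|f (x n)|)) => //.
apply: (@bounded_sum_cvg0 _ _ (C * (`|u| + 2 * M))) => // N.
(* [d] is the sum of the [x k] taken with the signs of [f (x k)]; its modulus stays below [S N]. *)
have [d dS <-] : exists2 d, abs d <<= S N & f d = \sum_(0 <= k < N) `|f (x k)|.
  elim: N => [|N [d dS fd]].
    exists 0; last by rewrite big_geq// (dual0 df).
    by rewrite /S big_geq// abs_id//; exact: vle_refl.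
  have ad : d <<= S N by exact: le_tr (le_abs d) dS.
  have aNd : - d <<= S N by exact: le_tr (le_absN d) dS.
  have Nx : - x N <<= x N.
    by apply: le_tr (x0 N); have := le_opp (x0 N); rewrite oppr0.
  rewrite SS big_nat_recr//= -fd.
  have [f0|f0] := leP 0 (f (x N)).
    exists (d + x N); last by rewrite (dualD df) ger0_norm.
    apply: join_le; first exact: le_addr.
    by rewrite opprD; exact: le_add.
  exists (d - x N); last by rewrite (dualD df) (dualN df) ltr0_norm.
  apply: join_le; first exact: le_add.
  by rewrite opprD opprK; exact: le_addr.
apply: le_trans (ler_norm _) _; apply: le_trans (fC d) _.
by apply: ler_wpM2l => //; apply: le_trans (norm_le dS) (Sn N).
Qed.
End BanachLatticeTheory.

(** * Positive operators *)

Lemma dual_comp {R : realType} {E F : normedModType R} (T : E -> F) (f : F -> R) :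
  bounded_linear T -> dual_elt f -> dual_elt (f \o T).
Proof.
move=> [Tlin Tc] [flin fc]; split=> [a x y|x] /=; first by rewrite Tlin flin.
by apply: continuous_comp; [exact: Tc|exact: fc].
Qed.

Section PositiveOperators.
Context {R : realType} {E F : normedModType R}.
Variables (leE : E -> E -> Prop) (joinE : E -> E -> E).
Variables (leF : F -> F -> Prop) (joinF : F -> F -> F).
Hypotheses (hE : banach_lattice leE joinE) (hF : banach_lattice leF joinF).
Variable T : E -> F.
Hypotheses (hT : bounded_linear T) (Tpos : positive_op leE leF T).

Lemma operator0 : T 0 = 0.
Proof. by have := hT.1 (-1) 0 0; rewrite !scaleN1r !addNr. Qed.

Lemma operatorD x y : T (x + y) = T x + T y.
Proof. by have := hT.1 1 x y; rewrite !scale1r. Qed.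

Lemma operatorN x : T (- x) = - T x.
Proof. by have := hT.1 (-1) x 0; rewrite !scaleN1r operator0 !addr0. Qed.

Lemma positive_le x y : leE x y -> leF (T x) (T y).
Proof.
move=> xy; have := Tpos (le_sub_ge0 hE xy); rewrite operatorD operatorN.
by move=> /(le_addr hF (T x)); rewrite add0r subrK.
Qed.

Lemma abs_positive_le x : leF (labs joinF (T x)) (T (labs joinE x)).
Proof.
apply: (join_le hF); first exact: positive_le (le_abs hE x).
by rewrite -operatorN; exact: positive_le (le_absN hE x).
Qed.

(* Otherwise, choosing greedily [x (k j)] with
   [e <= |T (|x (k j)| - 2^j s_j)^+|], where [s_j = sum_(i < j) |x (k i)|],
   gives a bounded uaw-null sequence that [T] does not send to [0]. *)
Lemma uaw_dunford_pettis_tail (x : nat -> E) (e : R) :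
  uaw_dunford_pettis leE joinE T -> norm_bounded x -> 0 < e ->
  exists2 u, leE 0 u & forall n, `|T (joinE (labs joinE (x n) - u) 0)| < e.
Proof.
move=> huaw [M xM] e0; apply: contrapT => h.
(* Positivity of [u] stands inside the existential so that [k] is total; any index serves when [u]
   is not positive. *)
have /choice[k kP] : forall u, exists n, leE 0 u ->
    e <= `|T (joinE (labs joinE (x n) - u) 0)|.
  move=> u; apply: contrapT => hu; apply: h; exists u.
    by apply: contrapT => uN0; apply: hu; exists 0%N.
  move=> n; rewrite ltNge; apply/negP => en; apply: hu; exists n => _; exact: en.
(* Each selection depends on the sum of the earlier terms, so [z] takes that sum as an argument and
   [s] is built by recursion through [z]. *)
pose z s j := labs joinE (x (k (2 ^+ j *: s))).
pose s := fix s j := if j is j'.+1 then s j' + z (s j') j' else 0.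
pose y j := z (s j) j.
pose w j := joinE (y j - 2 ^+ j *: s j) 0.
have y0 j : leE 0 (y j) by exact: (abs_ge0 hE).
have sS j : s j.+1 = s j + y j by [].
have s0 j : leE 0 (s j).
  elim: j => [|j IH]; first exact: (vle_refl hE).
  by rewrite sS; exact: (add_nneg hE).
have t0 j : leE 0 (2 ^+ j *: s j) by apply: (scale_nneg hE) => //; rewrite exprn_ge0.
have yM j : `|y j| <= M by rewrite /y /z (norm_abs hE).
have w_uaw : uaw_cvg leE joinE w 0.
  exact: (@truncated_tails_uaw_null _ _ _ _ hE y s w M).
have wM : norm_bounded w.
  exists M => j; apply: le_trans (yM j); apply: (norm_le_nneg hE); first exact: (pos_ge0 hE).
  by apply: (join_le hE) => //; exact: (le_sub_nneg hE).
have /cvg0P/(_ e e0)[N /(_ N (leqnn N))] := huaw w wM w_uaw.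
by rewrite normr_id ltNge => /negP; apply; exact: kP.
Qed.

Lemma positive_uaw_dunford_pettis :
  uaw_dunford_pettis leE joinE T -> discrete leF -> order_continuous_norm leF ->
  dunford_pettis T.
Proof.
move=> huaw dis oc x x0.
have Tx0 : weakly_cvg (T \o x) 0.
  move=> f df; have := x0 _ (dual_comp hT df).
  by rewrite /= operator0.
apply: cvg0_approx => e e0.
have [u u0 uP] := uaw_dunford_pettis_tail huaw (weakly_cvg_bounded x0) e0.
have Tu0 := Tpos u0.
exists (fun n => `|meet joinF (labs joinF (T (x n))) (T u)|).
  exact: (discrete_meet_null hF dis oc Tx0).
move=> n; rewrite normr_id; set v := joinE (labs joinE (x n) - u) 0.
have Tv0 : leF 0 (T v) by apply: Tpos; exact: (pos_ge0 hE).
have ab : leF (labs joinF (T (x n))) (T u + T v).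
  apply: (le_tr hF) (abs_positive_le _) _; rewrite -operatorD; apply: positive_le.
  by rewrite addrC; apply: (le_subr hE); exact: (le_pos hE).
(* An element below [T u + T v] equals its meet with that sum, so subadditivity of the meet splits
   it into a null part and a part of norm below [e]. *)
have mE : labs joinF (T (x n)) = meet joinF (labs joinF (T (x n))) (T u + T v).
  apply: (vle_anti hF); last exact: (meet_lel hF).
  by apply: (le_meet hF) => //; exact: (vle_refl hF).
have -> : `|T (x n)| = `|meet joinF (labs joinF (T (x n))) (T u + T v)|.
  by rewrite -mE (norm_abs hF).
apply: le_trans (norm_meet_add hF _ Tu0 Tv0) _.
rewrite lerD2l; apply: le_trans (ltW (uP n)).
apply: (norm_le_nneg hF); last exact: (meet_ler hF).
exact: (meet_abs_ge0 hF).
Qed.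
End PositiveOperators.

(** * The three cases *)

Unset Implicit Arguments.

Theorem theorem3p5 (R : realType) (E F : completeNormedModType R)
  (leE : E -> E -> Prop) (joinE : E -> E -> E)
  (leF : F -> F -> Prop) (joinF : F -> F -> F)
  (hE : banach_lattice leE joinE) (hF : banach_lattice leF joinF)
  (T : E -> F) (hT : bounded_linear T)
  (huaw : uaw_dunford_pettis leE joinE T) :
  wsc_lattice_ops joinE \/
  (discrete leE /\ order_continuous_norm leE) \/
  (positive_op leE leF T /\ discrete leF /\ order_continuous_norm leF) ->
  dunford_pettis T.
Proof.
case=> [wsc|[[dis oc]|[Tpos [dis oc]]]].
- move=> x x0; apply: huaw; first exact: weakly_cvg_bounded x0.
  exact: wsc_uaw_null x0.
- move=> x x0; apply: huaw; first exact: weakly_cvg_bounded x0.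
  (* Under (2) the meets converge to [0] even in norm. *)
  move=> u u0; apply: norm_cvg0_weakly.
  under eq_fun do rewrite subr0.
  exact: (discrete_meet_null hE dis oc x0).
- exact: (positive_uaw_dunford_pettis hE hF hT Tpos huaw dis oc).
Qed.
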